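(* Let $n$ be a positive integer, let $h = \max\{x \in \mathcal{H} : x \le n\}$, and let $d = n - h$. Then \[ \overline{D}(n) > 0.07\,(0.352)^d > 3^{-(d+3)}. \]
   Context: A Hadamard matrix of order $h$ is an $h\times h$ matrix $H$ with entries in $\{\pm1\}$ satisfying $HH^T = hI$. $\mathcal{H}$ denotes the set of positive integers $h$ for which a Hadamard matrix of order $h$ exists (so $1 \in \mathcal{H}$). $D(n)$ denotes the maximal determinant of an $n\times n$ matrix with entries in the real interval $[-1,1]$, and $\overline{D}(n) := D(n)/n^{n/2}$. *)

(* Defs.v *)
From HB Require Import structures.
From mathcomp Require Import all_boot all_order all_algebra.
From mathcomp Require Import all_classical all_reals all_analysis.

Set Implicit Arguments.
Unset Strict Implicit.
Unset Printing Implicit Defensive.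

Import Order.TTheory GRing.Theory Num.Theory.

Local Open Scope classical_set_scope.
Local Open Scope ring_scope.

Definition is_hadamard (h : nat) (H : 'M[int]_h) : Prop :=
  (forall i j, H i j = 1 \/ H i j = -1) /\ H *m H^T = (h%:R)%:M.

Definition hadamard_orders : set nat :=
  [set h | (0 < h)%N /\ exists H : 'M[int]_h, is_hadamard H].

(* The determinants range over the continuous image of a compact cube, so this
   [sup] is attained and is the maximal determinant. *)
Definition maxdet (R : realType) (n : nat) : R :=
  sup [set \det A | A in [set A : 'M[R]_n | forall i j, -1 <= A i j <= 1]].

Definition maxdet_ratio (R : realType) (n : nat) : R :=
  maxdet R n / n%:R `^ (n%:R / 2).

(* Main.v *)
Require Import Defs.
From HB Require Import structures.
From mathcomp Require Import all_boot all_order all_algebra all_fingroup.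
From mathcomp Require Import all_classical all_reals all_analysis.
From mathcomp Require Import ring lra zify.

Set Implicit Arguments.
Unset Strict Implicit.
Unset Printing Implicit Defensive.

Import Order.TTheory GRing.Theory Num.Theory.

Local Open Scope classical_set_scope.
Local Open Scope ring_scope.

(* Write n = h + d and let A be a Hadamard matrix of order h. Doubling A gives a
   Hadamard matrix of order 2h, hence d < h. There are two lower bounds.

   If 8 d <= 3 h, border A^T by a random sign block B and by C = sg (A B)^T, with
   a zero corner. Up to sign, the Schur complement is C A B / h. For a random sign
   vector v, distinct coordinates of sg (A v) and A v are uncorrelated, so the
   expectation of det (C A B) is mu^d h (h - 1) ... (h - d + 1), where
   mu = E|e_1 + ... + e_h| ~ sqrt (2 h / pi) for independent random signs e_i.

   If 8 d > 3 h, take a large n x n minor of the Hadamard matrix of order 2h: with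
   m = h - d, averaging over all choices of the columns yields a ratio of at least
   (m / 2h)^(m / 2), which is at least e^(- h / e) since x ln x >= - 1 / e, and
   this exceeds e^(- d).

   Both averages are instances of the same identity, sum_det_biorthogonal. *)

(** * Expected determinants over independent random indices *)

Lemma det_eq_fun (R : comPzRingType) (d m : nat) (f : {ffun 'I_d -> 'I_m}) :
  \det (\matrix_(i, j) (f i == f j)%:R) = (injectiveb f)%:R :> R.
Proof.
have [/injectiveP f_inj|/injectivePn[i [j neq_ij eq_fij]]] := boolP (injectiveb f).
  rewrite -[RHS](det1 R d); congr (\det _); apply/matrixP => i j.
  by rewrite !mxE (inj_eq f_inj).
by apply: (determinant_alternate neq_ij) => k; rewrite !mxE eq_fij.
Qed.

(* Averaged Cauchy-Binet: when the indices [F i] are drawn independently, the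
   expected determinant only depends on the second moments of [X] and [Y]. *)
Lemma sum_det_biorthogonal (R : comPzRingType) (S : finType) (d m : nat)
    (X Y : S -> 'I_m -> R) (c : R)
    (XY : forall k l, \sum_s X s k * Y s l = c * (k == l)%:R) :
  \sum_(F : {ffun 'I_d -> S})
     \det (\matrix_(i, j) \sum_k X (F i) k * Y (F j) k) = c ^+ d * (m ^_ d)%:R.
Proof.
transitivity (\sum_(f : {ffun 'I_d -> 'I_m}) c ^+ d * (injectiveb f)%:R); last first.
  rewrite -mulr_sumr -natr_sum.
  have card_inj : #|[set f : {ffun 'I_d -> 'I_m} | injectiveb f]%SET| = (m ^_ d)%N.
    by rewrite card_inj_ffuns !card_ord.
  rewrite -card_inj -sum1_card [in RHS]big_mkcond; congr (_ * _%:R).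
  by apply: eq_bigr => f _; rewrite inE; case: injectiveb.
(* Expand each product of sums over a choice [f] of inner indices. Using [s^-1] in the [Y] factor
   groups the factors by [F i], so for fixed [f] and [s] the sum over [F] splits into a product of
   second moments, each given by [XY]. *)
transitivity (\sum_(f : {ffun 'I_d -> 'I_m}) \sum_(s : 'S_d)
    \sum_(F : {ffun 'I_d -> S})
   (-1) ^+ s * \prod_i (X (F i) (f i) * Y (F i) (f ((s^-1)%g i)))).
  under [RHS]eq_bigr do rewrite exchange_big.
  rewrite [RHS]exchange_big; apply: eq_bigr => F _; rewrite [RHS]exchange_big.
  apply: eq_bigr => s _; rewrite -mulr_sumr; congr (_ * _).
  under eq_bigr do rewrite mxE.
  rewrite bigA_distr_bigA; apply: eq_bigr => f _.
  rewrite !big_split /=; congr (_ * _).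
  rewrite [RHS](reindex_perm s); apply: eq_bigr => i _.
  by rewrite permK.
apply: eq_bigr => f _; rewrite -det_eq_fun /determinant mulr_sumr.
rewrite [LHS](reindex_inj invg_inj); apply: eq_bigr => s _.
rewrite odd_permV invgK -mulr_sumr mulrCA; congr (_ * _).
rewrite -(bigA_distr_bigA (fun i t => X t (f i) * Y t (f (s i)))).
under eq_bigr do rewrite XY.
rewrite big_split /= prodr_const card_ord; congr (_ * _).
by apply: eq_bigr => i _; rewrite mxE.
Qed.

Lemma exists_ge_average (R : realFieldType) (S : finType) (P : pred S)
    (g : S -> R) (a : R) :
  (0 < #|P|)%N -> #|P|%:R * a <= \sum_(s in P) g s -> exists2 s, s \in P & a <= g s.
Proof.
move=> P_gt0 le_sum; apply/exists_inP; rewrite -[X in is_true X]negbK.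
apply/negP => /exists_inPn lt_a; move: le_sum; apply/negP; rewrite -ltNge.
have [s0 s0P] := card_gt0P P_gt0.
rewrite mulr_natl -sumr_const.
apply: ltr_sum => [|s /lt_a]; last by rewrite -ltNge.
by apply/hasP; exists s0; rewrite ?mem_index_enum.
Qed.

(** * Maximal determinants and minors of Hadamard matrices *)

Lemma norm_det_le_maxdet (R : realType) (n : nat) (A : 'M[R]_n) :
  (0 < n)%N -> (forall i j, -1 <= A i j <= 1) -> `|\det A| <= maxdet R n.
Proof.
case: n A => // n A _ A1.
have det_le (B : 'M[R]_n.+1) : (forall i j, -1 <= B i j <= 1) ->
    \det B <= maxdet R n.+1.
  move=> B1; apply: ub_le_sup; last by exists B.
  (* The Leibniz formula bounds every determinant by the number of permutations, so the [sup] is a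
     genuine upper bound. *)
  exists (\sum_(s : 'S_n.+1) 1) => _ [C C1 <-].
  apply: ler_sum => s _; apply: le_trans (ler_norm _) _.
  rewrite normrM normrX normrN1 expr1n mul1r normr_prod.
  by apply: prodr_ile1 => i _; rewrite normr_ge0 ler_norml C1.
have [_|_] := ger0P (\det A); first exact: det_le.
(* Negating the first row changes the sign of the determinant and keeps the entries in range. *)
pose D : 'rV[R]_n.+1 := \row_j (-1) ^+ (j == ord0).
have -> : - \det A = \det (diag_mx D *m A).
  rewrite det_mulmx det_diag big_ord_recl big1 ?mulr1 => [|i _].
    by rewrite mxE eqxx mulN1r.
  by rewrite mxE.
apply: det_le => i j; rewrite mul_diag_mx !mxE.
by case: eqP => _; rewrite ?mulN1r ?mul1r // lerN2 lerNl andbC A1.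
Qed.

(** Sylvester's doubling: the Kronecker product of the Hadamard matrix of order 2 with [H]. *)
Lemma is_hadamard_double (h : nat) (H : 'M[int]_h) :
  is_hadamard H -> is_hadamard (block_mx H H H (- H)).
Proof.
move=> [H1 HHT]; split.
  move=> i j; rewrite -[i]splitK -[j]splitK.
  case: (fintype.split i) => i'; case: (fintype.split j) => j' /=;
    rewrite ?block_mxEul ?block_mxEur ?block_mxEdl ?block_mxEdr ?mxE //.
  by case: (H1 i' j') => ->; [right | left].
rewrite tr_block_mx mulmx_block linearN /= !mulmxN !mulNmx !HHT opprK subrr.
by rewrite -raddfD -natrD scalar_mx_block.
Qed.

(** Two orthogonal sign rows disagree in exactly half of the columns. *)
Lemma is_hadamard_even (h : nat) (H : 'M[int]_h) :
  (1 < h)%N -> is_hadamard H -> ~~ odd h.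
Proof.
case: h H => [|[|h]] // H _ [H1 HHT].
have : \sum_j H ord0 j * H (inord 1) j = 0.
  have /matrixP/(_ ord0 (inord 1)) := HHT; rewrite !mxE -val_eqE /= inordK //.
  by rewrite mulr0n => HH; rewrite -[RHS]HH; apply: eq_bigr => j _; rewrite mxE.
have mulE j : H ord0 j * H (inord 1) j = 1 - (H ord0 j != H (inord 1) j)%:R *+ 2.
  by case: (H1 ord0 j) => ->; case: (H1 (inord 1) j) => ->.
under eq_bigr do rewrite mulE.
rewrite sumrB sumr_const card_ord sumrMnl -natr_sum -mulrnA => /eqP.
rewrite subr_eq0 eqr_nat => /eqP ->.
by rewrite oddM andbF.
Qed.

(** Taking [X = Y] to be the first [n] rows, the squared minors over all column choices sum to
    [N^n n!]. A repeated column contributes zero, so the average over the [N ^_ n] injective choices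
    is [N^n / 'C(N, n)]. *)
Lemma maxdet_minor_ge (R : realType) (N n : nat) (A : 'M[R]_N) :
    (forall i j, A i j = 1 \/ A i j = -1) -> A *m A^T = N%:R%:M ->
    (0 < n <= N)%N ->
  N%:R ^+ n <= maxdet R n ^+ 2 * 'C(N, n)%:R.
Proof.
move=> A1 AAT /andP[n_gt0 le_nN].
pose X (s : 'I_N) (k : 'I_n) := A (widen_ord le_nN k) s.
have XX k l : \sum_s X s k * X s l = N%:R * (k == l)%:R.
  have /matrixP/(_ (widen_ord le_nN k) (widen_ord le_nN l)) := AAT.
  rewrite !mxE mulr_natr => <-; apply: eq_bigr => s _; by rewrite mxE.
pose M (F : {ffun 'I_n -> 'I_N}) : 'M[R]_n := \matrix_(i, k) X (F i) k.
have detE (F : {ffun 'I_n -> 'I_N}) :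
    \det (\matrix_(i, j) \sum_k X (F i) k * X (F j) k) = \det (M F) ^+ 2.
  rewrite expr2 -[in X in _ = _ * X]det_tr -det_mulmx; congr (\det _).
  by apply/matrixP => i j; rewrite !mxE; apply: eq_bigr => k _; rewrite !mxE.
have := sum_det_biorthogonal n XX; under eq_bigr do rewrite detE.
rewrite ffactnn => sumE.
have card_inj : #|[set F : {ffun 'I_n -> 'I_N} | injectiveb F]%SET| = (N ^_ n)%N.
  by rewrite card_inj_ffuns !card_ord.
have ffact_n0 : (N ^_ n)%:R != 0 :> R by rewrite pnatr_eq0 -lt0n ffact_gt0.
have [] := @exists_ge_average R _ (mem [set F : {ffun 'I_n -> 'I_N} | injectiveb F]%SET)
    (fun F => \det (M F) ^+ 2) (N%:R ^+ n * n`!%:R / (N ^_ n)%:R).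
- by rewrite card_inj ffact_gt0.
- rewrite card_inj mulrCA divff // mulr1 -sumE.
  rewrite (bigID (mem [set F : {ffun 'I_n -> 'I_N} | injectiveb F]%SET)) /=.
  rewrite [X in _ + X]big1 ?addr0 // => F; rewrite inE.
  case/injectivePn => i [j neq_ij eq_Fij].
  by rewrite (determinant_alternate neq_ij) ?expr0n // => k; rewrite !mxE eq_Fij.
move=> F _; rewrite ler_pdivrMr ?ltr0n ?ffact_gt0 //.
rewrite -bin_ffact natrM mulrA ler_pM2r ?ltr0n ?fact_gt0 // => /le_trans; apply.
have detM_le : `|\det (M F)| <= maxdet R n.
  apply: norm_det_le_maxdet => // i j; rewrite mxE /X.
  by case: (A1 (widen_ord le_nN j) (F i)) => ->; lra.
rewrite ler_wpM2r // -real_normK ?num_real // lerXn2r ?nnegrE //.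
exact: le_trans detM_le.
Qed.

(** * Random sign vectors and their correlations *)

Section SignSums.

Variables (R : realType) (h : nat).
Implicit Types (S : {set 'I_h}) (i : 'I_h).

(** A sign vector is encoded by the set of its negative coordinates, so a sum over all sets is a sum
    over the cube. *)
Definition sign_at S i : R := (-1) ^+ (i \in S).

(** Equal to [2 ^ h] times the mean [mu] of the absolute value of a sum of [h] random signs. *)
Definition sum_norm_sign : R := \sum_S `|\sum_i sign_at S i|.

Definition flip (w : 'I_h -> R) S : {set 'I_h} :=
  [set i | (i \in S) (+) (w i == -1)]%SET.

Lemma sign_at_flip (w : 'I_h -> R) S i : (forall i, w i = 1 \/ w i = -1) ->
  sign_at (flip w S) i = w i * sign_at S i.
Proof.
move=> /(_ i) w1; rewrite /sign_at inE signr_addb mulrC; congr (_ * _).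
have neq1N1 : (1 == -1 :> R) = false by apply/negbTE/eqP; lra.
by case: w1 => ->; rewrite ?eqxx ?neq1N1 ?expr1 ?expr0.
Qed.

Lemma sum_flip (w : 'I_h -> R) (g : {set 'I_h} -> R) :
  \sum_S g S = \sum_S g (flip w S).
Proof.
apply: reindex_inj; apply: (can_inj (g := flip w)) => S.
by apply/setP => i; rewrite !inE -addbA addbb addbF.
Qed.

(** Transposing the coordinates [i] and [j] permutes the cube and fixes the total sum. *)
Lemma sum_sg_sign_at i j :
  \sum_S Num.sg (\sum_k sign_at S k) * sign_at S i =
  \sum_S Num.sg (\sum_k sign_at S k) * sign_at S j.
Proof.
pose swap S := [set k | tperm i j k \in S]%SET.
have swapK : involutive swap by move=> S; apply/setP => k; rewrite !inE tpermK.
rewrite [LHS](reindex_inj (inv_inj swapK)); apply: eq_bigr => S _ /=.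
have sign_swap k : sign_at (swap S) k = sign_at S (tperm i j k) by rewrite /sign_at inE.
rewrite sign_swap tpermL; congr (Num.sg _ * _).
rewrite [RHS](reindex_inj (@perm_inj _ (tperm i j))); exact: eq_bigr.
Qed.

(* Flipping signs turns row [k] into the all-ones row and row [l] into
   [A k * A l], whose entries sum to zero; every coordinate of the random sign
   vector then has the same correlation with the sign of its sum. *)
Lemma sum_sg_mul_row (A : 'M[R]_h) (k l : 'I_h) :
  (forall i j, A i j = 1 \/ A i j = -1) -> A *m A^T = h%:R%:M ->
  \sum_S Num.sg (\sum_i A k i * sign_at S i) * (\sum_i A l i * sign_at S i) =
  sum_norm_sign * (k == l)%:R.
Proof.
move=> A1 AAT; rewrite (sum_flip (A k)).
have flipE l' S : \sum_i A l' i * sign_at (flip (A k) S) i =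
    \sum_i A l' i * A k i * sign_at S i.
  by apply: eq_bigr => i _; rewrite (sign_at_flip _ _ (A1 k)) mulrA.
under eq_bigr do rewrite !flipE.
have AkAk i : A k i * A k i = 1 by case: (A1 k i) => ->; rewrite ?mulrNN mulr1.
have flipk S : \sum_i A k i * A k i * sign_at S i = \sum_i sign_at S i.
  by apply: eq_bigr => i _; rewrite AkAk mul1r.
under eq_bigr do rewrite flipk.
have [<-|neq_kl] := eqVneq k l.
  by rewrite mulr1; apply: eq_bigr => S _; rewrite flipk normrEsg.
rewrite mulr0; under eq_bigr do rewrite mulr_sumr.
rewrite exchange_big /=.
under eq_bigr => i _.
  under eq_bigr do rewrite mulrCA.
  rewrite -mulr_sumr (sum_sg_sign_at i k).
  over.
rewrite -mulr_suml; have /matrixP/(_ l k) := AAT; rewrite !mxE eq_sym (negbTE neq_kl).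
by rewrite mulr0n; under eq_bigr do rewrite mxE; move=> ->; rewrite mul0r.
Qed.

End SignSums.

(** * Bordering a Hadamard matrix *)

Lemma maxdet_border_ge (R : realType) (h d : nat) (A : 'M[R]_h) :
  (0 < h)%N -> (forall i j, A i j = 1 \/ A i j = -1) -> A *m A^T = h%:R%:M ->
  h%:R ^+ h * ((sum_norm_sign R h / 2 ^+ h) ^+ d * (h ^_ d)%:R) ^+ 2 <=
    maxdet R (h + d) ^+ 2 * h%:R ^+ d.*2.
Proof.
move=> h_gt0 A1 AAT.
pose v S k : R := \sum_i A k i * sign_at R S i.
have vv k l : \sum_S Num.sg (v S k) * v S l = sum_norm_sign R h * (k == l)%:R.
  exact: sum_sg_mul_row.
have := sum_det_biorthogonal d vv; set T := sum_norm_sign R h => sumE.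
have card_F : #|{: {ffun 'I_d -> {set 'I_h}}}| = ((2 ^ h) ^ d)%N.
  by rewrite card_ffun card_ord -cardsT -powersetT card_powerset cardsT card_ord.
have [||F _] := @exists_ge_average R _ (mem {: {ffun 'I_d -> {set 'I_h}}})
   (fun F => \det (\matrix_(i, j) \sum_k Num.sg (v (F i) k) * v (F j) k))
   ((T / 2 ^+ h) ^+ d * (h ^_ d)%:R).
- by rewrite card_F !expn_gt0.
- rewrite card_F sumE expr_div_n !natrX mulrA [_ * (_ / _)]mulrC divfK //.
pose B : 'M[R]_(h, d) := \matrix_(i, j) sign_at R (F j) i.
pose C : 'M[R]_(d, h) := \matrix_(i, k) Num.sg (v (F i) k).
have -> : (\matrix_(i, j) \sum_k Num.sg (v (F i) k) * v (F j) k) = C *m (A *m B).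
  apply/matrixP => i j; rewrite !mxE; apply: eq_bigr => k _; rewrite !mxE.
  by congr (_ * _); apply: eq_bigr => l _; rewrite mxE.
set a := _ * _%:R; set D := C *m _ => le_aD.
have a_ge0 : 0 <= a.
  by rewrite mulr_ge0 // exprn_ge0 // divr_ge0 ?exprn_ge0 // sumr_ge0.
pose M := block_mx A^T B C 0.
have detM_le : `|\det M| <= maxdet R (h + d).
  apply: norm_det_le_maxdet; first by rewrite addn_gt0 h_gt0.
  move=> i j; rewrite -[i]splitK -[j]splitK.
  case: (fintype.split i) => i'; case: (fintype.split j) => j' /=;
    rewrite ?block_mxEul ?block_mxEur ?block_mxEdl ?block_mxEdr ?mxE.
  - by case: (A1 j' i') => ->; lra.
  - by rewrite /sign_at; case: (_ \in _); rewrite ?expr1 ?expr0; lra.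
  (* The sign may be 0, which is admissible since entries range over an interval. *)
  - by case: sgrP => _; lra.
  - lra.
have detA2 : \det A ^+ 2 = h%:R ^+ h.
  by rewrite expr2 -[in X in _ * X = _]det_tr -det_mulmx AAT det_scalar.
(* Multiply [M] on the left by the lower block triangular matrix with blocks [A], [0], [- C A],
   [h I]; the product is upper block triangular with diagonal blocks [h I] and [- D]. *)
have detE : \det A * h%:R ^+ d * \det M = h%:R ^+ h * \det (- D).
  rewrite -det_scalar -(det_lblock A (- (C *m A))) -det_mulmx.
  rewrite -[h%:R ^+ h]det_scalar -(det_ublock _ (A *m B)) mulmx_block AAT.
  congr (\det (block_mx _ _ _ _)).
  - by rewrite mul0mx addr0.
  - by rewrite mulmx0 addr0.
  - by rewrite mulNmx -mulmxA AAT mul_mx_scalar mul_scalar_mx addrC subrr.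
  - by rewrite mulNmx -mulmxA mulmx0 addr0.
have h_neq0 : h%:R != 0 :> R by rewrite pnatr_eq0 -lt0n.
(* Squaring removes the unknown sign of [\det A] and turns it into [h^h], which cancels. *)
have : (\det M) ^+ 2 * h%:R ^+ d.*2 = h%:R ^+ h * \det D ^+ 2.
  have : (\det A * h%:R ^+ d * \det M) ^+ 2 = (h%:R ^+ h * \det (- D)) ^+ 2 by rewrite detE.
  rewrite -scaleN1r detZ !exprMn detA2 -exprM muln2 -[((-1) ^+ d) ^+ 2]exprM.
  rewrite muln2 -signr_odd odd_double mul1r [(h%:R ^+ h) ^+ 2]expr2 -!mulrA.
  by move/(mulfI (expf_neq0 _ h_neq0)) => <-; rewrite mulrA -expr2 mulrC.
rewrite -real_normK ?num_real // => detM2.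
apply: (@le_trans _ _ (h%:R ^+ h * \det D ^+ 2)).
  by rewrite ler_wpM2l ?exprn_ge0 // lerXn2r ?nnegrE // (le_trans a_ge0).
rewrite -detM2 ler_wpM2r ?exprn_ge0 // lerXn2r ?nnegrE //.
exact: le_trans detM_le.
Qed.

(** * The mean absolute value of a sum of signs *)

Lemma sum_card_set (R : nmodType) (T : finType) (g : nat -> R) :
  \sum_(S : {set T}) g #|S| = \sum_(0 <= j < #|T|.+1) g j *+ 'C(#|T|, j).
Proof.
rewrite big_mkord.
rewrite (partition_big (fun S : {set T} => inord #|S| : 'I_#|T|.+1) xpredT) //=.
apply: eq_bigr => j _; rewrite -card_draws -sumr_const.
by apply: eq_big => [S|S /eqP <-]; rewrite ?inE -?val_eqE /= inordK // ltnS max_card.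
Qed.

(** Grouping sets by their size [j], the terms [(2k - 2j) 'C(2k, j)] are the increments of
    [F j = j 'C(2k, j)]. The absolute value reverses their sign from [j = k] on, so both halves
    telescope to [F k]. *)
Lemma sum_norm_signE (R : realType) (k : nat) :
  sum_norm_sign R k.*2 = (k.*2 * 'C(k.*2, k))%:R.
Proof.
have sum_sign (S : {set 'I_k.*2}) :
    \sum_i sign_at R S i = (k.*2)%:R - #|S|.*2%:R.
  have signE i : sign_at R S i = 1 - (i \in S)%:R *+ 2.
    by rewrite /sign_at; case: (_ \in _) => /=; rewrite ?expr1 ?expr0; lra.
  under eq_bigr do rewrite signE.
  rewrite sumrB sumr_const card_ord sumrMnl -natr_sum -mulrnA muln2.
  congr (_ - _.*2%:R); rewrite -sum1_card [in RHS]big_mkcond /=.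
  by apply: eq_bigr => i _; case: (_ \in _).
rewrite /sum_norm_sign; under eq_bigr do rewrite sum_sign.
rewrite (sum_card_set _ (fun j => `|(k.*2)%:R - j.*2%:R| : R)) card_ord.
rewrite (@big_cat_nat _ _ _ k) //=; last by lia.
pose F j : R := (j * 'C(k.*2, j))%:R.
have FB j : (j <= k.*2)%N -> F j.+1 - F j = ((k.*2)%:R - j.*2%:R) *+ 'C(k.*2, j).
  move=> le_j; rewrite /F mul_bin_left !natrM natrB // -[RHS]mulr_natr -[j.*2]muln2 natrM.
  ring.
rewrite (telescope_sumr_eq F) //; last first.
  move=> j /andP[_ lt_jk]; rewrite FB; last by lia.
  by rewrite ger0_norm // subr_ge0 ler_nat; lia.
rewrite (telescope_sumr_eq (fun j => - F j)); [|by lia|]; last first.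
  move=> j /andP[le_kj lt_j]; have FBj := FB j ltac:(lia).
  rewrite ler0_norm; last by rewrite subr_le0 ler_nat; lia.
  by rewrite mulNrn -FBj; ring.
rewrite /F; have -> : 'C(k.*2, k.*2.+1) = 0%N by rewrite bin_small.
set C := 'C(k.*2, k); rewrite muln0 mul0n -muln2 !natrM; ring.
Qed.

Lemma central_binS (k : nat) :
  (k.+1 * 'C(k.+1.*2, k.+1) = 2 * (k.*2.+1 * 'C(k.*2, k)))%N.
Proof.
have := mul_bin_diag k.+1.*2 k; have := mul_bin_down k.*2.+1 k; rewrite /=.
have -> : (k.*2.+1 - k = k.+1)%N by lia.
lia.
Qed.

(* The right-hand side increases to [2 / pi]. The correction [1 / (8 k)] makes the
   bound an equality at [k = 1] and stable under the recurrence. *)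
Lemma central_bin_sq_ge (R : realFieldType) (k : nat) : (0 < k)%N ->
  5 / 8 - 1 / (8 * k%:R) <= k.*2%:R * ('C(k.*2, k)%:R / 4 ^+ k) ^+ 2 :> R.
Proof.
elim: k => // -[_ _|k IHk _].
  have -> : 'C(1.*2, 1) = 2%N by [].
  by rewrite expr1 (_ : 1.*2 = 2%N) //; lra.
have {IHk} := IHk isT; set x := k.+1%:R : R.
set C := 'C(k.+1.*2, k.+1)%:R; set c := C / _.
have x_gt0 : 0 < x by rewrite ltr0n.
have x1E : k.+2%:R = x + 1 :> R by rewrite /x -natr1.
have cS : 'C(k.+2.*2, k.+2)%:R / 4 ^+ k.+2 = c * (2 * x + 1) / (2 * (x + 1)).
  have /(congr1 (fun m => m%:R : R)) := central_binS k.+1.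
  rewrite /= !natrM -[k.+1.*2.+1%:R]natr1 -[in k.+1.*2%:R]muln2 natrM x1E -/x => E.
  have x1_neq0 : x + 1 != 0 by rewrite gt_eqF // ltr_wpDr.
  have -> : 'C(k.+2.*2, k.+2)%:R = 2 * ((x * 2 + 1) * C) / (x + 1).
    by rewrite -E mulrC mulKf.
  rewrite /c [4 ^+ k.+2]exprS; have p_neq0 : 4 ^+ k.+1 != 0 :> R by rewrite expf_neq0 // pnatr_eq0.
  move: (4 ^+ k.+1) p_neq0 (x) x1_neq0 => p p_neq0 y y1_neq0; field.
  by rewrite y1_neq0.
rewrite cS -!muln2 !natrM x1E -/x => IHk.
have -> : (x + 1) * 2 * (c * (2 * x + 1) / (2 * (x + 1))) ^+ 2 =
    (x * 2 * c ^+ 2) * (1 + 1 / (4 * x * (x + 1))).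
  by field; rewrite !gt_eqF // ltr_wpDr.
apply: le_trans (ler_wpM2r _ IHk); last first.
  by rewrite addr_ge0 // divr_ge0 // !mulr_ge0 ?addr_ge0 // ltW.
rewrite -subr_ge0.
have x_ge1 : 1 <= x by rewrite ler1n.
(* The slack of the induction step is nonnegative for [x >= 1] and vanishes at [x = 1]. *)
have -> : (5 / 8 - 1 / (8 * x)) * (1 + 1 / (4 * x * (x + 1))) -
   (5 / 8 - 1 / (8 * (x + 1))) = (x - 1) / (32 * x ^+ 2 * (x + 1)).
  by field; rewrite !gt_eqF // ltr_wpDr.
by rewrite divr_ge0 ?subr_ge0 // !mulr_ge0 ?exprn_ge0 ?addr_ge0 // ltW.
Qed.

Lemma sum_norm_sign_sq_ge (R : realType) (h : nat) : (0 < h)%N -> ~~ odd h ->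
  (5 / 8 - 1 / (4 * h%:R)) * h%:R <= (sum_norm_sign R h / 2 ^+ h) ^+ 2.
Proof.
move=> h_gt0 h_even; have [k hE] : exists k, h = k.*2.
  by exists h./2; rewrite -[LHS]odd_double_half (negbTE h_even).
rewrite {}hE double_gt0 in h_gt0 *; rewrite sum_norm_signE.
have := central_bin_sq_ge R h_gt0; set c := _%:R / 4 ^+ _ => le_c.
have -> : (k.*2 * 'C(k.*2, k))%:R / 2 ^+ k.*2 = k.*2%:R * c :> R.
  rewrite natrM -mulrA /c (_ : 4 = 2 ^+ 2 :> R) -?exprM ?mul2n //; ring.
rewrite exprMn expr2 -mulrA mulrC ler_wpM2l //; apply: le_trans le_c.
by rewrite -[k.*2]muln2 natrM [_ * 2]mulrC mulrA -natrM.
Qed.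

(** * Logarithmic and numerical estimates *)

Lemma ln_le_subr1 (R : realType) (x : R) : 0 < x -> ln x <= x - 1.
Proof.
by move=> x_gt0; have := @le_ln1Dx R (x - 1); rewrite subrKC; apply; lra.
Qed.

(** The lower bound is the integral of [ln] from [h - d] to [h]. The induction step amounts to
    [x ln ((x + 1) / x) <= 1] with [x = h - d - 1]. *)
Lemma ln_ffact_ge (R : realType) (h d : nat) : (d < h)%N ->
  h%:R * ln h%:R - (h - d)%:R * ln (h - d)%:R - d%:R <= ln (h ^_ d)%:R :> R.
Proof.
elim: d => [|d IHd] lt_dh; first by rewrite ffactn0 ln1 subn0; lra.
have {IHd} := IHd (ltnW lt_dh); rewrite ffactnSr natrM lnM ?posrE ?ltr0n ?ffact_gt0 //; try lia.
have -> : (h - d = (h - d.+1).+1)%N by lia.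
have : (0 < h - d.+1)%N by lia.
move: (h - d.+1)%N => k k_gt0; rewrite -!natr1.
have x_gt0 : 0 < k%:R :> R by rewrite ltr0n.
set x := k%:R in x_gt0 *.
have : ln ((x + 1) / x) <= (x + 1) / x - 1 by rewrite ln_le_subr1 // divr_gt0 //; lra.
rewrite ln_div ?posrE //; last by lra.
rewrite mulrDl divff ?gt_eqF // addrAC subrr add0r => /(ler_wpM2l (ltW x_gt0)).
rewrite mulrA mulr1 divff ?gt_eqF //; lra.
Qed.

(** Convexity of [x ln x] between 1, where it vanishes, and [u]. It follows from [ln z <= z - 1] at
    [z = w] and [z = w / u], with weights [1 - t] and [t u]. *)
Lemma xlnx_chord (R : realType) (t u : R) : 0 <= t <= 1 -> 0 < u ->
  (1 - t + t * u) * ln (1 - t + t * u) <= t * (u * ln u).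
Proof.
move=> /andP[t_ge0 t_le1] u_gt0; set w := 1 - t + t * u.
have w_gt0 : 0 < w.
  rewrite /w; have [->|t_neq0] := eqVneq t 0; first lra.
  have : 0 < t * u by rewrite mulr_gt0 // lt_neqAle eq_sym t_neq0.
  lra.
have ln_w : (1 - t) * ln w <= (1 - t) * (w - 1).
  by rewrite ler_wpM2l ?ln_le_subr1 //; lra.
have ln_wu : t * u * ln (w / u) <= t * u * (w / u - 1).
  by rewrite ler_wpM2l ?ln_le_subr1 ?divr_gt0 ?mulr_ge0 // ltW.
move: ln_wu; rewrite ln_div ?posrE // [t * u * (_ - 1)]mulrBr [t * u * _]mulrC.
have -> : t * u * (w / u) = t * w by field; rewrite gt_eqF.
have -> : w * ln w = (1 - t) * ln w + t * u * ln w by rewrite {1}/w; ring.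
by rewrite /w in ln_w *; lra.
Qed.

(** Halve the exponent repeatedly: the fractions approximate [exp (2^-k)] from below, then from
    above. The chains end with [1 + x <= exp x] at [1/32] and at [-1/256]. *)
Lemma expR1_bounds (R : realType) : 8 / 3 <= expR (1 : R) <= 273 / 100.
Proof.
have half (x : R) : expR x = expR (x / 2) * expR (x / 2).
  by rewrite -expRD; congr expR; field.
have step_ge (x a b : R) : 0 <= b -> b <= expR (x / 2) -> a <= b * b -> a <= expR x.
  by move=> b_ge0 le_b /le_trans; apply; rewrite (half x) ler_pM.
have step_le (x a b : R) : expR (x / 2) <= a -> a * a <= b -> expR x <= b.
  by move=> le_a; apply: le_trans; rewrite (half x) ler_pM ?expR_ge0.
apply/andP; split.
  apply: (@step_ge _ _ (247 / 151)); [lra| |lra].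
  apply: (@step_ge _ _ (298 / 233)); [lra| |lra].
  apply: (@step_ge _ _ (406 / 359)); [lra| |lra].
  apply: (@step_ge _ _ (419 / 394)); [lra| |lra].
  apply: (@step_ge _ _ (33 / 32)); [lra| |lra].
  by apply: le_trans (expR_ge1Dx _); lra.
apply: (@step_le _ (1081 / 655)); last lra.
apply: (@step_le _ (176 / 137)); last lra.
apply: (@step_le _ (756 / 667)); last lra.
apply: (@step_le _ (1532 / 1439)); last lra.
apply: (@step_le _ (1330 / 1289)); last lra.
apply: (@step_le _ (515 / 507)); last lra.
apply: (@step_le _ (513 / 509)); last lra.
apply: (@step_le _ (256 / 255)); last lra.
set x := _ / 2; rewrite -[x]opprK expRN -[leRHS]invrK.
have u_gt0 : 0 < (256 / 255)^-1 :> R by lra.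
rewrite lef_pV2 ?posrE ?expR_gt0 //.
by apply: le_trans (expR_ge1Dx _); rewrite /x; lra.
Qed.

Lemma ln_lt_N1 (R : realType) (x : R) : 0 < x -> x * (273 / 100) < 1 -> ln x < -1.
Proof.
move=> x_gt0 x_lt; have /andP[_ e_le] := expR1_bounds R.
rewrite -[ltRHS]expRK ltr_ln ?posrE ?expR_gt0 //.
rewrite expRN -ltf_pV2 ?posrE ?expR_gt0 ?invr_gt0 ?expR_gt0 // invrK.
apply: le_lt_trans e_le _.
by rewrite -[ltRHS]mulr1 ltr_pdivlMl.
Qed.

(* Tangent to [x ln x] at [3 / 8], which is slightly more than the minimiser
   [1 / e]. *)
Lemma xlnx_ge (R : realType) (x : R) : 0 < x -> - (3 / 8) <= x * ln x.
Proof.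
move=> x_gt0; have /andP[e_ge _] := expR1_bounds R.
have ln38 : -1 <= ln (3 / 8 : R).
  rewrite -[leLHS]expRK ler_ln ?posrE ?expR_gt0 ?divr_gt0 //.
  rewrite expRN -[leRHS]invrK lef_pV2 ?posrE ?expR_gt0 ?invr_gt0 ?divr_gt0 //.
  by apply: le_trans e_ge; lra.
have : x * ln (3 / 8 / x) <= x * (3 / 8 / x - 1).
  by rewrite ler_wpM2l ?ln_le_subr1 ?divr_gt0 // ltW.
rewrite ln_div ?posrE ?divr_gt0 // [x * (3 / 8 / x - 1)]mulrBr mulrCA divff ?gt_eqF //.
have : x * -1 <= x * ln (3 / 8 : R) by rewrite ler_wpM2l // ltW.
lra.
Qed.

(** Exponentiating and replacing [e] by [273/100] reduces a bound on logarithms to a comparison of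
    powers. *)
Lemma ln_exponent_ge (R : realType) (a b c p q : R) :
  0 < a -> 0 < b -> 0 < c -> 0 < p -> 0 < q ->
  b * (273 / 100 * c) ^+ 6 * p ^+ 11 <= a ^+ 3 * q ^+ 10 ->
  ln b <= 10 * ln q - 11 * ln p + 3 * ln a - 6 - 6 * ln c.
Proof.
have /andP[_] := expR1_bounds R; have : 0 < 273 / 100 :> R by lra.
move: (273 / 100) => e e_gt0 e_ge a_gt0 b_gt0 c_gt0 p_gt0 q_gt0.
have ln_e : 1 <= ln e by rewrite -[leLHS]expRK ler_ln ?posrE ?expR_gt0.
rewrite -ler_ln ?posrE ?mulr_gt0 ?exprn_gt0 ?mulr_gt0 //.
have -> : ln (b * (e * c) ^+ 6 * p ^+ 11) = ln b + 6 * (ln e + ln c) + 11 * ln p.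
  rewrite lnM ?posrE ?mulr_gt0 ?exprn_gt0 ?mulr_gt0 // lnM ?posrE ?exprn_gt0 ?mulr_gt0 //.
  by rewrite !lnXn ?mulr_gt0 // lnM // !mulr_natl.
have -> : ln (a ^+ 3 * q ^+ 10) = 3 * ln a + 10 * ln q.
  by rewrite lnM ?posrE ?exprn_gt0 // !lnXn // !mulr_natl.
lra.
Qed.

(* The constant [18 / 29] needs [h >= 64]; for smaller [h] we have [d <= 24] and
   the factor [7 / 100] makes up for the weaker bound [1 / 2] on [a]. *)
Lemma border_exponent_gt (R : realType) (h d : nat) (a : R) :
  (8 * d <= 3 * h)%N -> 1 / 2 <= a -> ((64 <= h)%N -> 18 / 29 <= a) ->
  6 * ln (7 / 100) <
    d%:R * (10 * ln (8 / 5) - 11 * ln (11 / 8) + 3 * ln a - 6 - 6 * ln (44 / 125)).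
Proof.
move=> le_dh a_ge a_ge64; have a_gt0 : 0 < a by lra.
have c_gt0 : 0 < 44 / 125 :> R by lra.
have p_gt0 : 0 < 11 / 8 :> R by lra.
have q_gt0 : 0 < 8 / 5 :> R by lra.
have ln07_lt0 : ln (7 / 100) < 0 :> R by apply: ln_lt0; lra.
have [ge64|lt64] := leqP 64 h.
  have E := ln_exponent_ge a_gt0 ltr01 c_gt0 p_gt0 q_gt0.
  apply: (@lt_le_trans _ _ 0); first lra.
  apply: mulr_ge0; first exact: ler0n.
  apply: le_trans (E _); first by rewrite ln1.
  apply: (@le_trans _ _ ((18 / 29) ^+ 3 * (8 / 5) ^+ 10)); first lra.
  apply: ler_wpM2r; first by apply: exprn_ge0; lra.
  by apply: lerXn2r; [rewrite nnegrE; lra | rewrite nnegrE; lra | exact: a_ge64].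
have d_le24 : (d <= 24)%N by clear -le_dh lt64; lia.
(* Chosen so that [(13/25)^4 > 7/100]: since [d <= 24], the loss [(13/25)^d] stays above
   [(7/100)^6]. *)
have b_gt0 : 0 < 13 / 25 :> R by lra.
have /= E := ln_exponent_ge a_gt0 b_gt0 c_gt0 p_gt0 q_gt0.
have lnb_lt0 : ln (13 / 25) < 0 :> R by apply: ln_lt0; lra.
have ln07_lt : ln (7 / 100) < 4 * ln (13 / 25) :> R.
  rewrite [ltRHS]mulr_natl -lnXn //.
  have : 7 / 100 < (13 / 25) ^+ 4 :> R by lra.
  have : 0 < 7 / 100 :> R by lra.
  move: (7 / 100) => l l_gt0 lt_l.
  by rewrite ltr_ln ?posrE ?exprn_gt0.
have d_le : d%:R <= 24 :> R by rewrite (ler_nat R d 24).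
apply: (@lt_le_trans _ _ (d%:R * ln (13 / 25))).
  have := ler_wnM2r (ltW lnb_lt0) d_le; lra.
apply: ler_wpM2l; first exact: ler0n.
apply: E; apply: (@le_trans _ _ ((1 / 2) ^+ 3 * (8 / 5) ^+ 10)); first lra.
apply: ler_wpM2r; first by apply: exprn_ge0; lra.
by apply: lerXn2r; [rewrite nnegrE; lra | rewrite nnegrE; lra | exact: a_ge].
Qed.

(** The bordering bound after taking logarithms, with [a], [b], [c] standing for logarithms. Chords
    over [0 <= d/h <= 3/8] bound [(h + d) ln (1 + d/h)] and [(h - d) ln (1 - d/h)] linearly in [d];
    three times the resulting inequality is the hypothesis. *)
Lemma border_ln_lt (R : realType) (h d : nat) (a b c : R) :
  (0 < h)%N -> (8 * d <= 3 * h)%N ->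
  6 * b < d%:R * (10 * ln (8 / 5) - 11 * ln (11 / 8) + 3 * a - 6 - 6 * c) ->
  (h + d)%:R * ln (h + d)%:R + 2 * (b + d%:R * c) + 2 * (d%:R * ln h%:R) <
  h%:R * ln h%:R + d%:R * (a + ln h%:R) + 2 * ln (h ^_ d)%:R.
Proof.
move=> h_gt0 le_dh exponent.
have hR_gt0 : 0 < h%:R :> R by rewrite ltr0n.
have := @ln_ffact_ge R h d ltac:(lia); rewrite natrB ?natrD; last lia.
have : 8 * d%:R <= 3 * h%:R :> R by rewrite -!natrM ler_nat.
move: hR_gt0 exponent; set x := h%:R; set y := d%:R => x_gt0 exponent le_yx.
have y_ge0 : 0 <= y by rewrite ler0n.
(* With [t = 8d / (3h)], the chord points for [u = 5/8] and [u = 11/8] are [1 - d/h] and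
   [1 + d/h]. *)
have t_bounds : 0 <= 8 / 3 * (y / x) <= 1.
  have yx_ge0 : 0 <= y / x by rewrite divr_ge0 // ltW.
  have : y / x <= 3 / 8 by rewrite ler_pdivrMr //; lra.
  by move=> le_yx38; apply/andP; split; lra.
have chord_lo := @xlnx_chord R (8 / 3 * (y / x)) (5 / 8) t_bounds ltac:(lra).
have chord_hi := @xlnx_chord R (8 / 3 * (y / x)) (11 / 8) t_bounds ltac:(lra).
have xDy_gt0 : 0 < x + y by lra.
have xBy_gt0 : 0 < x - y by lra.
have lo : (x - y) * (ln (x - y) - ln x) <= y * (5 / 3 * ln (5 / 8)).
  move: chord_lo => /(ler_wpM2l (ltW x_gt0)).
  have -> : 1 - 8 / 3 * (y / x) + 8 / 3 * (y / x) * (5 / 8) = (x - y) / x.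
    by field; rewrite gt_eqF.
  rewrite ln_div ?posrE // => le_lo.
  have -> : (x - y) * (ln (x - y) - ln x) = x * ((x - y) / x * (ln (x - y) - ln x)).
    by field; rewrite gt_eqF.
  apply: le_trans le_lo _; rewrite le_eqVlt; apply/orP; left; apply/eqP.
  by field; rewrite gt_eqF.
have hi : (x + y) * (ln (x + y) - ln x) <= y * (11 / 3 * ln (11 / 8)).
  move: chord_hi => /(ler_wpM2l (ltW x_gt0)).
  have -> : 1 - 8 / 3 * (y / x) + 8 / 3 * (y / x) * (11 / 8) = (x + y) / x.
    by field; rewrite gt_eqF.
  rewrite ln_div ?posrE // => le_hi.
  have -> : (x + y) * (ln (x + y) - ln x) = x * ((x + y) / x * (ln (x + y) - ln x)).
    by field; rewrite gt_eqF.
  apply: le_trans le_hi _; rewrite le_eqVlt; apply/orP; left; apply/eqP.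
  by field; rewrite gt_eqF.
have ln58 : ln (5 / 8) = - ln (8 / 5) :> R by rewrite -lnV ?posrE ?divr_gt0 // invf_div.
rewrite ln58 in lo.
lra.
Qed.

(** * The two lower bounds for the maximal determinant *)

Lemma bin_mul_expn_le (n m : nat) :
  ('C(n + m, n) * (n ^ n * m ^ m) <= (n + m) ^ (n + m))%N.
Proof.
rewrite [X in (_ <= X ^ _)%N]addnC expnDn.
have lt_n : (n < (n + m).+1)%N by rewrite ltnS leq_addr.
(* Keep a single term of the binomial expansion. *)
by rewrite (bigD1 (Ordinal lt_n)) //= addKn [(m ^ m * _)%N]mulnC leq_addr.
Qed.

Lemma hadamard_border_gt (R : realType) (h d : nat) (A : 'M[R]_h) :
  (0 < h)%N -> ~~ odd h -> (8 * d <= 3 * h)%N ->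
  (forall i j, A i j = 1 \/ A i j = -1) -> A *m A^T = h%:R%:M ->
  (7 / 100 * (44 / 125) ^+ d) ^+ 2 * (h + d)%:R ^+ (h + d) < maxdet R (h + d) ^+ 2.
Proof.
move=> h_gt0 h_even le_dh A1 AAT.
have hR_gt0 : 0 < h%:R :> R by rewrite ltr0n.
have nR_gt0 : 0 < (h + d)%:R :> R by rewrite ltr0n addn_gt0 h_gt0.
have fR_gt0 : 0 < (h ^_ d)%:R :> R by rewrite ltr0n ffact_gt0; lia.
(* A lower bound for [mu^2 / h], at least [1/2] for [h >= 2] and at least [18/29] for [h >= 64]. *)
pose a : R := 5 / 8 - 1 / (4 * h%:R).
have h_ge2 : (2 <= h)%N by case: h h_gt0 h_even {A A1 AAT le_dh hR_gt0 nR_gt0 fR_gt0 a} => [|[]].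
have a_ge : 1 / 2 <= a.
  have : h%:R^-1 <= 2^-1 :> R by rewrite lef_pV2 ?posrE // (ler_nat R 2).
  by rewrite /a div1r invfM; lra.
have a_ge64 : (64 <= h)%N -> 18 / 29 <= a.
  move=> ge64; have : h%:R^-1 <= 64^-1 :> R by rewrite lef_pV2 ?posrE // (ler_nat R 64).
  by rewrite /a div1r invfM; lra.
have a_gt0 : 0 < a by lra.
have := border_ln_lt h_gt0 le_dh (border_exponent_gt le_dh a_ge a_ge64).
have b_gt0 : 0 < 7 / 100 :> R by rewrite divr_gt0.
have c_gt0 : 0 < 44 / 125 :> R by rewrite divr_gt0.
move: (7 / 100) (44 / 125) b_gt0 c_gt0 => b c b_gt0 c_gt0 ln_lt.
have := maxdet_border_ge d h_gt0 A1 AAT.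
have := sum_norm_sign_sq_ge R h_gt0 h_even; rewrite -/a.
set mu := sum_norm_sign R h / _ => mu_ge D_ge.
rewrite -(@ltr_pM2r _ (h%:R ^+ d.*2)) ?exprn_gt0 //.
apply: lt_le_trans D_ge.
apply: (@lt_le_trans _ _ (h%:R ^+ h * ((a * h%:R) ^+ d * (h ^_ d)%:R ^+ 2))).
  rewrite -ltr_ln ?posrE ?mulr_gt0 ?exprn_gt0 ?mulr_gt0 ?exprn_gt0 //.
  have -> : ln ((b * c ^+ d) ^+ 2 * (h + d)%:R ^+ (h + d) * h%:R ^+ d.*2) =
      (h + d)%:R * ln (h + d)%:R + 2 * (ln b + d%:R * ln c) + 2 * (d%:R * ln h%:R).
    rewrite lnM ?posrE ?mulr_gt0 ?exprn_gt0 ?mulr_gt0 ?exprn_gt0 //.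
    rewrite lnM ?posrE ?exprn_gt0 ?mulr_gt0 ?exprn_gt0 //.
    rewrite lnXn ?mulr_gt0 ?exprn_gt0 // lnM ?posrE ?exprn_gt0 // !lnXn //.
    by rewrite -muln2; ring.
  have -> : ln (h%:R ^+ h * ((a * h%:R) ^+ d * (h ^_ d)%:R ^+ 2)) =
      h%:R * ln h%:R + d%:R * (ln a + ln h%:R) + 2 * ln (h ^_ d)%:R.
    rewrite lnM ?posrE ?mulr_gt0 ?exprn_gt0 ?mulr_gt0 //.
    rewrite [ln (_ * (h ^_ d)%:R ^+ 2)]lnM ?posrE ?exprn_gt0 ?mulr_gt0 //.
    rewrite !lnXn ?mulr_gt0 // lnM ?posrE //; ring.
  exact: ln_lt.
rewrite ler_wpM2l ?exprn_ge0 // [(mu ^+ d * _) ^+ 2]exprMn ler_wpM2r ?exprn_ge0 //.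
rewrite -exprM mulnC exprM; apply: lerXn2r => //.
  by rewrite nnegrE mulr_ge0 // ltW.
by rewrite nnegrE exprn_even_ge0.
Qed.

Lemma hadamard_minor_gt (R : realType) (h d : nat) (A : 'M[R]_(h + h)) :
  (d < h)%N -> (3 * h < 8 * d)%N ->
  (forall i j, A i j = 1 \/ A i j = -1) -> A *m A^T = (h + h)%:R%:M ->
  (7 / 100 * (44 / 125) ^+ d) ^+ 2 * (h + d)%:R ^+ (h + d) < maxdet R (h + d) ^+ 2.
Proof.
move=> lt_dh lt_hd A1 AAT.
pose m := (h - d)%N; pose n := (h + d)%N; pose H : R := (h + h)%:R.
have nmE : (n + m = h + h)%N by rewrite /n /m; lia.
have H_gt0 : 0 < H by rewrite ltr0n; lia.
have n_gt0 : 0 < n%:R :> R by rewrite ltr0n /n; lia.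
have m_gt0 : 0 < m%:R :> R by rewrite ltr0n /m; lia.
have b_gt0 : 0 < 7 / 100 :> R by lra.
have b_lt1 : 7 / 100 < 1 :> R by lra.
have c_gt0 : 0 < 44 / 125 :> R by lra.
have : ln (44 / 125) < -1 :> R by apply: ln_lt_N1 => //; lra.
move: (7 / 100) (44 / 125) b_gt0 b_lt1 c_gt0 => b c b_gt0 b_lt1 c_gt0 ln_c.
have D_ge := @maxdet_minor_ge R (h + h) n A A1 AAT ltac:(rewrite /n; lia).
have := bin_mul_expn_le n m; rewrite nmE -(ler_nat R) !natrM !natrX -/H => bin_le.
(* The minor and binomial bounds leave [n^n (m/H)^m] to compare with the target. Here
   [m ln (m/H) >= - 3H/8 >= - 2d], whereas [ln c < -1] and [ln b < 0]. *)
have mm_gt : (b * c ^+ d) ^+ 2 * H ^+ m < m%:R ^+ m.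
  rewrite -ltr_ln ?posrE ?mulr_gt0 ?exprn_gt0 ?mulr_gt0 ?exprn_gt0 //.
  have -> : ln ((b * c ^+ d) ^+ 2 * H ^+ m) = 2 * (ln b + d%:R * ln c) + m%:R * ln H.
    rewrite lnM ?posrE ?exprn_gt0 ?mulr_gt0 ?exprn_gt0 //.
    rewrite (lnXn 2) ?(lnXn m) ?mulr_gt0 ?exprn_gt0 // lnM ?posrE ?exprn_gt0 //.
    by rewrite lnXn //; ring.
  rewrite lnXn // -[ltRHS]mulr_natl.
  have ln_b : ln b < 0 by rewrite ln_lt0 // b_gt0.
  have dc : d%:R * ln c <= d%:R * -1 by rewrite ler_wpM2l // ltW.
  have := @xlnx_ge R (m%:R / H) (divr_gt0 m_gt0 H_gt0).
  move=> /(ler_wpM2l (ltW H_gt0)); rewrite ln_div ?posrE // mulrA.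
  rewrite [H * (_ / _)]mulrC divfK ?gt_eqF //.
  have : 3 * H <= 16 * d%:R by rewrite /H -!natrM ler_nat; lia.
  lra.
rewrite -(@ltr_pM2r _ (H ^+ m)) ?exprn_gt0 //.
apply: (@lt_le_trans _ _ (n%:R ^+ n * m%:R ^+ m)).
  by rewrite mulrAC [ltLHS]mulrC ltr_pM2l ?exprn_gt0.
rewrite -(@ler_pM2l _ (H ^+ n)) ?exprn_gt0 // [leRHS]mulrCA -exprD nmE.
apply: le_trans (ler_wpM2r _ D_ge) _; first by rewrite mulr_ge0 ?exprn_ge0.
by rewrite -mulrA ler_wpM2l // exprn_even_ge0.
Qed.

Lemma hadamard_det_ge (R : realType) (h : nat) (A : 'M[R]_h) :
  (0 < h)%N -> (forall i j, A i j = 1 \/ A i j = -1) -> A *m A^T = h%:R%:M ->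
  h%:R ^+ h <= maxdet R h ^+ 2.
Proof.
move=> h_gt0 A1 AAT.
have := maxdet_minor_ge A1 AAT (n := h); rewrite h_gt0 leqnn binn mulr1; exact.
Qed.

(** * Normalised determinants and the final case split *)

Lemma maxdet_ratio_gt (R : realType) (n : nat) (x : R) : (0 < n)%N -> 0 <= x ->
  x ^+ 2 * n%:R ^+ n < maxdet R n ^+ 2 -> x < maxdet_ratio R n.
Proof.
move=> n_gt0 x_ge0 lt_x; rewrite /maxdet_ratio.
have nR_gt0 : 0 < n%:R :> R by rewrite ltr0n.
have p_gt0 : 0 < n%:R `^ (n%:R / 2) :> R by rewrite powR_gt0.
have D_ge0 : 0 <= maxdet R n.
  apply: le_trans (@norm_det_le_maxdet R n 0 n_gt0 _) => // i j.
  by rewrite mxE; lra.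
rewrite ltr_pdivlMr // -(@ltr_pXn2r _ 2) ?nnegrE ?mulr_ge0 // 1?ltW //.
have -> : (x * n%:R `^ (n%:R / 2)) ^+ 2 = x ^+ 2 * n%:R ^+ n.
  rewrite exprMn; congr (_ * _).
  by rewrite -(powR_mulrn 2 (ltW p_gt0)) -powRrM divfK // powR_mulrn // ltW.
exact: lt_x.
Qed.

Theorem theorem4 (R : realType) (n : nat) (hn : (0 < n)%N) :
  let h := (\max_(x < n.+1 | nat_of_ord x \in hadamard_orders) x)%N in
  let d := (n - h)%N in
  maxdet_ratio R n > 7 / 100 * (352 / 1000) ^+ d /\
  7 / 100 * (352 / 1000) ^+ d > 3 ^- (d + 3) :> R.
Proof.
set P := fun x : 'I_n.+1 => nat_of_ord x \in hadamard_orders.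
(* Order 1 makes the index set nonempty, so the maximum is attained rather than being the default
   0. *)
have P1 : P (inord 1).
  rewrite /P inordK // inE; split=> //; exists 1%:M; split.
    by move=> i j; left; rewrite mxE !ord1.
  by rewrite trmx1 mulmx1.
have [i0 Pi0 hE] : {i0 | P i0 & (\max_(x < n.+1 | P x) x = i0)%N}.
  have := @eq_bigmax_cond _ P (fun x : 'I_n.+1 => x : nat).
  by case=> [|i0 ? ->]; [apply/card_gt0P; exists (inord 1) | exists i0].
have h_max (x : nat) : x \in hadamard_orders -> (x <= n)%N ->
    (x <= \max_(x < n.+1 | P x) x)%N.
  move=> Hx le_xn; have := @leq_bigmax_cond _ P (fun x : 'I_n.+1 => x : nat) (inord x).
  by rewrite /P inordK //; apply.
move=> h d; have -> : 352 / 1000 = 44 / 125 :> R by lra.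
have {Pi0 hE} [h_had le_hn] : h \in hadamard_orders /\ (h <= n)%N.
  by rewrite /h hE; split=> //; rewrite -ltnS.
(* Induction on [d], from [7/100 > 1/27] and [44/125 > 1/3]. *)
split; last first.
  elim: d => [|d IHd]; first by rewrite expr0 add0n; lra.
  rewrite addSn !exprS invfM mulrCA.
  apply: lt_le_trans (_ : 3^-1 * (7 / 100 * (44 / 125) ^+ d) <= _).
    by rewrite ltr_pM2l.
  rewrite ler_wpM2r ?mulr_ge0 ?exprn_ge0 //; lra.
have := h_had; rewrite inE => -[h_gt0 [H H_had]].
have [H1 HHT] := H_had.
pose toR m (M : 'M[int]_m) : 'M[R]_m := map_mx intr M.
have toR_had m (M : 'M[int]_m) : is_hadamard M ->
    (forall i j, toR m M i j = 1 \/ toR m M i j = -1) /\ toR m M *m (toR m M)^T = m%:R%:M.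
  move=> [M1 MMT]; split=> [i j|]; first by rewrite mxE; case: (M1 i j) => ->; [left | right].
  by rewrite /toR map_trmx -map_mxM MMT map_scalar_mx /= rmorph_nat.
have lt_d : (d < h)%N.
  have [le_2hn|] := leqP (h + h) n; last by rewrite /d; lia.
  suff /h_max/(_ le_2hn) : (h + h)%N \in hadamard_orders by rewrite -/h; lia.
  rewrite inE; split; first by rewrite addn_gt0 h_gt0.
  by exists (block_mx H H H (- H)); apply: is_hadamard_double.
have nE : (n = h + d)%N by rewrite /d; lia.
rewrite nE; apply: maxdet_ratio_gt; first by rewrite addn_gt0 h_gt0.
  by rewrite mulr_ge0 ?exprn_ge0.
have [A1 AAT] := toR_had _ _ H_had.
(* For [d = 0] the order [h] may be 1, which is odd; [0 < d < h] forces [h > 1], so [h] is even. *)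
have [d0|d_gt0] := posnP d.
  rewrite d0 addn0 expr0 mulr1; apply: lt_le_trans (hadamard_det_ge h_gt0 A1 AAT).
  by rewrite -[ltRHS]mul1r ltr_pM2r ?exprn_gt0 ?ltr0n //; lra.
have [le_dh|lt_hd] := leqP (8 * d) (3 * h).
  by apply: hadamard_border_gt A1 AAT => //; apply: is_hadamard_even H_had; lia.
have [A1' AAT'] := toR_had _ _ (is_hadamard_double H_had).
exact: hadamard_minor_gt A1' AAT'.
Qed.
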